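(* For every integer $n>0$ there exists a unique sequence $c^n_1,\ldots,c^n_n$ of rational numbers such that, for every commutative superalgebra $A$ over a field of characteristic $0$ and every linear operator $f\colon A\to A$, one has $$\Phi^{n+1}_f=\big(c_1^n\rho_1^n+c^n_2\rho_1^{n-2}\rho_2+c^n_3\rho_1^{n-3}\rho_3+\cdots+c^n_n\rho_n\big)f,$$ that is, $\Phi^{n+1}_f=\sum_{k=1}^{n}c^n_k\,\rho_1^{\,n-k}\rho_k(f)$.
   Context: Superalgebras are associative and $\mathbb{Z}/2$-graded, not necessarily unital; $|a|\in\{0,1\}$ is the parity of a homogeneous element $a$, and commutative means $ab=(-1)^{|a||b|}ba$. Linear operators may be even, odd, or sums of both. Shuffles and signs: $S(p,q)$ is the set of permutations $\sigma$ of $p+q$ ordered indices that are increasing on the first $p$ indices and on the last $q$ indices. The Koszul sign of $\sigma$ with respect to homogeneous elements $a_1,\dots,a_n$ is $\epsilon(\sigma)=(-1)^\alpha$, where $\alpha$ is the number of pairs $i<j$ with $\sigma(i)>\sigma(j)$ and $|a_{\sigma(i)}||a_{\sigma(j)}|=1$. Higher antibrackets: for $f\colon A\to A$ linear and $n\ge 1$, $\Phi^n_f\colon A^{\odot n}\to A$ is $$\Phi^n_f(a_1,\ldots,a_n)=\sum_{k=1}^n(-1)^{n-k}\sum_{\sigma\in S(k,n-k)}\epsilon(\sigma)\,f(a_{\sigma(1)}\cdots a_{\sigma(k)})\,a_{\sigma(k+1)}\cdots a_{\sigma(n)}.$$ $D_n(A)=\mathrm{Hom}^*(A^{\odot n+1},A)$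 is the super vector space of all (even and odd) supersymmetric multilinear maps in $n+1$ variables; $D(A)=\prod_{n\ge0}D_n(A)$. For $f\in D_n(A)$, $g\in D_m(A)$ put $$(f\barwedge g)(v_0,\ldots,v_{n+m})=\sum_{\sigma\in S(m+1,n)}\epsilon(\sigma)\,f\big(g(v_{\sigma(0)},\ldots,v_{\sigma(m)}),v_{\sigma(m+1)},\ldots,v_{\sigma(m+n)}\big),$$ and $[f,g]=f\barwedge g-(-1)^{|f||g|}g\barwedge f\in D_{n+m}(A)$ (Nijenhuis–Richardson bracket), extended componentwise to $D(A)$. Multiplication operators: $\mu_n\in D_n(A)$, $\mu_n(a_0,\ldots,a_n)=a_0a_1\cdots a_n$; and $\rho_n\colon D(A)\to D(A)$, $\rho_n(\omega)=[\mu_n,\omega]$. Products and powers of the $\rho_k$ are compositions; $f$ is viewed as an element of $D_0(A)$. *)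

(* Defs.v *)
From HB Require Import structures.
From mathcomp Require Import all_boot all_order all_fingroup all_algebra.

Set Implicit Arguments.
Unset Strict Implicit.
Unset Printing Implicit Defensive.

Import GRing.Theory.
Local Open Scope ring_scope.

(* A Z/2-grading V = V_0 (+) V_1 is given by the projections hcomp i : V -> V_i
   onto its homogeneous components (false = even, true = odd); thus
   V_i = {a | hcomp i a = a}. *)
HB.mixin Record Lmodule_isSuper (K : fieldType) V of GRing.Lmodule K V := {
  hcomp : bool -> V -> V;
  hcomp_is_linear : forall i, linear (hcomp i);
  hcomp_hcomp : forall i j a,
    hcomp i (hcomp j a) = if i == j then hcomp j a else 0;
  hcomp_sum : forall a, hcomp false a + hcomp true a = a
}.

#[short(type="superLmodType")]
HB.structure Definition SuperLmodule (K : fieldType) :=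
  {V of Lmodule_isSuper K V & GRing.Lmodule K V}.

Definition homogeneous (K : fieldType) (V : superLmodType K) (i : bool) (a : V) :=
  hcomp i a = a.

(* The product of an associative superalgebra; there is no unit, so the ring
   structures of the library do not apply. *)
HB.mixin Record SuperLmodule_isSuperalgebra (K : fieldType) A
    of SuperLmodule K A := {
  smul : A -> A -> A;
  smulA : associative smul;
  smul_linearl : forall b, linear (smul^~ b);
  smul_linearr : forall a, linear (smul a);
  smul_homogeneous : forall i j (a b : A),
    homogeneous i a -> homogeneous j b -> homogeneous (i (+) j) (smul a b)
}.

#[short(type="superalgType")]
HB.structure Definition Superalgebra (K : fieldType) :=
  {A of SuperLmodule_isSuperalgebra K A & SuperLmodule K A}.

HB.mixin Record Superalgebra_isCommutative (K : fieldType) A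
    of Superalgebra K A := {
  smulC : forall i j (a b : A),
    homogeneous i a -> homogeneous j b -> smul a b = (-1) ^+ (i && j) *: smul b a
}.

#[short(type="comSuperalgType")]
HB.structure Definition ComSuperalgebra (K : fieldType) :=
  {A of Superalgebra_isCommutative K A & Superalgebra K A}.

(* S(p, n - p); a permutation s maps the position i to the index s i. *)
Definition shuffle (p n : nat) : {set 'S_n} :=
  [set s : 'S_n | [forall i : 'I_n, forall j : 'I_n,
     ((i < j) && ((j < p) || (p <= i)) ==> (s i < s j))%N]].

(* The Koszul sign of s for homogeneous arguments of parities par. *)
Definition koszul (K : fieldType) (n : nat) (par : 'I_n -> bool) (s : 'S_n) : K :=
  (-1) ^+ #|[set ij : 'I_n * 'I_n |
     [&& (ij.1 < ij.2)%N, (s ij.2 < s ij.1)%N, par (s ij.1) & par (s ij.2)]]|.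

Section Cochains.
Variables (K : fieldType) (A : superalgType K).

(* a_1 a_2 ... a_n, for n >= 1 *)
Definition sprod (v : seq A) : A := foldl smul (head 0 v) (behead v).

(* Formulas containing Koszul signs are stated for homogeneous arguments. They
   are extended multilinearly: each of the n arguments is split into its
   homogeneous components and one sums over the parities par of the components.
   hargs selects the components of parities par, and permute puts the arguments
   in the order v_(s 0), v_(s 1), ... *)
Definition hargs (n : nat) (par : 'I_n -> bool) (v : seq A) : seq A :=
  [seq hcomp (par i) v`_i | i <- enum 'I_n].

Definition permute (n : nat) (s : 'S_n) (v : seq A) : seq A :=
  [seq v`_(s i) | i <- enum 'I_n].

(* The product b a_1 ... a_r (r = 0 allowed) is foldl smul b [:: a_1; ...; a_r] *)
Definition antibracket (n : nat) (f : A -> A) (v : n.-tuple A) : A :=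
  \sum_(par : {ffun 'I_n -> bool}) \sum_(1 <= k < n.+1) (-1) ^+ (n - k) *:
    \sum_(s in shuffle k n)
       let w := permute s (hargs par v) in
       koszul K par s *: foldl smul (f (sprod (take k w))) (drop k w).

(* An element F of D(A) = prod_n D_n(A) is encoded as a function on finite
   sequences: its component in D_n(A) is the restriction of F to sequences of
   size n.+1. The value at the empty sequence is irrelevant. The formulas below
   make sense for arbitrary functions; the equalities with the usual operations
   refer to families of supersymmetric multilinear maps. *)
Definition cochain := seq A -> A.

Definition in_degree (n : nat) (F : cochain) : cochain :=
  fun v => if size v == n.+1 then F v else 0.

Definition cochain_of_operator (f : A -> A) : cochain :=
  in_degree 0 (fun v => f (head 0 v)).

Definition mu (n : nat) : cochain := in_degree n sprod.

(* The component of parity i: it shifts the parity of homogeneous arguments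
   by i. *)
Definition cpart (i : bool) (F : cochain) : cochain := fun v =>
  \sum_(par : {ffun 'I_(size v) -> bool})
    hcomp (i (+) \big[addb/false]_(j < size v) par j) (F (hargs par v)).

(* On sequences of size n + m + 1 this sums the products of the components of
   F in D_n(A) and of G in D_m(A). *)
Definition barwedge (F G : cochain) : cochain := fun v =>
  \sum_(par : {ffun 'I_(size v) -> bool}) \sum_(m < size v)
    \sum_(s in shuffle m.+1 (size v))
      let w := permute s (hargs par v) in
      koszul K par s *: F (G (take m.+1 w) :: drop m.+1 w).

Definition bracket (F G : cochain) : cochain := fun v =>
  \sum_(i : bool) \sum_(j : bool)
    (barwedge (cpart i F) (cpart j G) v
     - (-1) ^+ (i && j) *: barwedge (cpart j G) (cpart i F) v).

Definition rho (n : nat) (F : cochain) : cochain := bracket (mu n) F.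

End Cochains.

Arguments mu {K A}.

(* Main.v *)
(* Write T_p for the cochain sending a_1, ..., a_N to the signed sum over the
   (p, N - p)-shuffles of f(product of p arguments) times the remaining ones.
   Coassociativity and cocommutativity of the unshuffle coproduct show that
   rho_k maps T_p in N variables to
     (C(q, k) - C(q, k + 1)) T_p - C(p + k, k + 1) T_(p + k),  q = N + k - p,
   in N + k variables. As f = T_1, the claim becomes a statement about the
   coefficients of T_1, ..., T_(n+1), where Phi_f^(n+1) has coefficients (-1)^q.
   The n vectors rho_1^(n-k) rho_k f are linearly independent: rho_1 is
   injective, and rho_n f is not in its image because the coefficient
   C(q, 1) - C(q, 2) of T_p in rho_1 T_p vanishes at q = 3 (for n <= 2 one checks
   this directly). They all lie in the
   hyperplane of the coefficients that vanish on derivations, hence span it,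
   and it contains Phi_f^(n+1). Uniqueness follows from independence because in
   the polynomial algebra, for f the projection onto the monomial X^p, only T_p
   is nonzero at (X, ..., X). *)

Require Import Defs.
From HB Require Import structures.
From mathcomp Require Import all_boot all_order all_fingroup all_algebra.
From mathcomp Require Import ring lra zify.
Import Order.TTheory GRing.Theory Num.Theory.
Local Open Scope ring_scope.

Set Implicit Arguments.
Unset Strict Implicit.
Unset Printing Implicit Defensive.

(** * Unshuffle sums *)

Definition lpar (X : Type) (L : seq (bool * X)) := \big[addb/false]_(x <- L) x.1.

Lemma lpar_cons (X : Type) (x : bool * X) L : lpar (x :: L) = x.1 (+) lpar L.
Proof. exact: big_cons. Qed.

Lemma lpar_nil (X : Type) : lpar (@nil (bool * X)) = false.
Proof. exact: big_nil. Qed.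

Lemma lpar_cat (X : Type) (L M : seq (bool * X)) : lpar (L ++ M) = lpar L (+) lpar M.
Proof. exact: big_cat. Qed.

Lemma perm_lpar (X : eqType) (L M : seq (bool * X)) : perm_eq L M -> lpar L = lpar M.
Proof. exact: perm_big. Qed.

Section Unshuffle.
Variables (K : fieldType) (V : lmodType K).

(* The sum of [h a b] with its Koszul sign over all splittings of [L] into
   complementary subsequences [a] and [b]; the booleans are the parities. *)
Fixpoint unsh (X : Type) (h : seq (bool * X) -> seq (bool * X) -> V)
    (L : seq (bool * X)) : V :=
  if L is x :: L' then
    unsh (fun a b => h (x :: a) b) L'
    + unsh (fun a b => (-1) ^+ (x.1 && lpar a) *: h a (x :: b)) L'
  else h [::] [::].

(** Only complementary parts occur in the sum. The hypothesis on [a ++ b] is how sizes, parities and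
    homogeneity pass from [L] to its parts. *)
Lemma eq_unsh (X : eqType) (h h' : seq (bool * X) -> seq (bool * X) -> V) L :
  (forall a b, perm_eq (a ++ b) L -> h a b = h' a b) -> unsh h L = unsh h' L.
Proof.
elim: L h h' => [|x L IH] h h' hh' /=; first exact: hh'.
congr (_ + _); apply: IH => a b pab; first by apply: hh'; rewrite /= perm_cons.
by rewrite hh' // perm_catC /= perm_cons perm_catC.
Qed.


Lemma unshD (X : eqType) (h h' : seq (bool * X) -> seq (bool * X) -> V) L :
  unsh (fun a b => h a b + h' a b) L = unsh h L + unsh h' L.
Proof.
elim: L h h' => [|x L IH] h h' //=.
rewrite IH addrACA; congr (_ + _); rewrite -IH.
by apply: eq_unsh => a b _; exact: scalerDr.
Qed.

Lemma unshZ (X : eqType) (h : seq (bool * X) -> seq (bool * X) -> V) k L :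
  unsh (fun a b => k *: h a b) L = k *: unsh h L.
Proof.
elim: L h => [|x L IH] h //=.
rewrite IH scalerDr; congr (_ + _); rewrite -IH.
by apply: eq_unsh => a b _; rewrite !scalerA mulrC.
Qed.

Lemma unsh0 (X : eqType) (h : seq (bool * X) -> seq (bool * X) -> V) L :
  (forall a b, perm_eq (a ++ b) L -> h a b = 0) -> unsh h L = 0.
Proof.
move=> h0; rewrite (eq_unsh (h' := fun a b => 0 *: h a b)) ?unshZ ?scale0r //.
by move=> a b /h0 ->; rewrite scaler0.
Qed.

Lemma unsh_map (X Y : eqType) (g : bool * X -> bool * Y)
    (h : seq (bool * Y) -> seq (bool * Y) -> V) L : (forall x, (g x).1 = x.1) ->
  unsh h (map g L) = unsh (fun a b => h (map g a) (map g b)) L.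
Proof.
move=> gE; elim: L h => [|x L IH] h //=.
rewrite !IH; congr (_ + _); apply: eq_unsh => a b _.
by rewrite gE /lpar big_map; under eq_bigr do rewrite gE.
Qed.


(** Both sides sum over the splittings of [L] into three parts, and the induction follows the part
    that receives the first label. In the last part its sign is taken past [a] and [c] together and
    factors. *)
Lemma unsh_coassoc (X : eqType)
    (h : seq (bool * X) -> seq (bool * X) -> seq (bool * X) -> V) L :
  unsh (fun e d => unsh (fun a c => h a c d) e) L =
  unsh (fun a b => unsh (fun c d => h a c d) b) L.
Proof.
elim: L h => [|x L IH] h //=.
rewrite unshD (IH (fun a c d => h (x :: a) c d)) -!addrA; congr (_ + _).
rewrite (IH (fun a c d => (-1) ^+ (x.1 && lpar a) *: h a (x :: c) d)).
rewrite [X in _ + X = _](eq_unsh (h' := fun e d => unsh (fun a c =>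
   (-1) ^+ (x.1 && lpar a) *: ((-1) ^+ (x.1 && lpar c) *: h a c (x :: d))) e)).
  rewrite (IH (fun a c d =>
    (-1) ^+ (x.1 && lpar a) *: ((-1) ^+ (x.1 && lpar c) *: h a c (x :: d)))).
  rewrite -unshD; apply: eq_unsh => a b _.
  by rewrite scalerDr -!unshZ.
move=> e d _; rewrite -unshZ; apply: eq_unsh => a c /perm_lpar <-.
by rewrite lpar_cat andb_addr signr_addb scalerA.
Qed.

(** Exchanging the blocks interchanges the two branches of the recursion; the sign of the exchange
    accounts for the difference of their signs. *)
Lemma unsh_cocomm (X : eqType) (h : seq (bool * X) -> seq (bool * X) -> V) L :
  unsh (fun a c => (-1) ^+ (lpar a && lpar c) *: h c a) L = unsh h L.
Proof.
elim: L h => [|x L IH] h /=; first by rewrite lpar_nil scale1r.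
rewrite -[X in _ = X + _]IH -[X in _ = _ + X]IH addrC.
congr (_ + _); apply: eq_unsh => a b _; rewrite lpar_cons ?scalerA.
  rewrite -!signr_addb; congr (_ ^+ _ *: _).
  by case: x.1 (lpar a) (lpar b) => [] [] [].
rewrite -!signr_addb; congr (_ ^+ _ *: _).
by case: x.1 (lpar a) (lpar b) => [] [] [].
Qed.

(** Coassociativity brings [a] and [c] into one block, where cocommutativity exchanges them. *)
Lemma unsh_swap (X : eqType)
    (h : seq (bool * X) -> seq (bool * X) -> seq (bool * X) -> V) L :
  unsh (fun a b => unsh (fun c d => (-1) ^+ (lpar a && lpar c) *: h a c d) b) L =
  unsh (fun c b => unsh (fun a d => h a c d) b) L.
Proof.
rewrite -(unsh_coassoc (fun a c d => (-1) ^+ (lpar a && lpar c) *: h a c d)).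
rewrite -(unsh_coassoc (fun c a d => h a c d)); apply: eq_unsh => e d _.
exact: (unsh_cocomm (fun c a => h a c d)).
Qed.

Section Symmetric.
Variables (X : eqType) (Q : pred (bool * X)).

(** [Q] restricts the rule to admissible labels: products obey it only when each label carries the
    true parity of its entry. *)
Definition supersymmetric (S : seq (bool * X) -> V) :=
  forall l x y r, all Q (l ++ x :: y :: r) ->
    S (l ++ y :: x :: r) = (-1) ^+ (x.1 && y.1) *: S (l ++ x :: y :: r).

Lemma supersymmetric_cons S x : Q x -> supersymmetric S ->
  supersymmetric (fun L => S (x :: L)).
Proof.
by move=> Qx Ssym l y z r Qr; apply: (Ssym (x :: l)); rewrite /= Qx.
Qed.

Lemma supersymmetric_move S x a b : supersymmetric S -> all Q (x :: a ++ b) ->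
  (-1) ^+ (x.1 && lpar a) *: S (a ++ x :: b) = S (x :: a ++ b).
Proof.
elim: a S => [|y a IH] S Ssym; first by rewrite lpar_nil andbF scale1r.
move=> /= /and3P[Qx Qy Qab].
rewrite lpar_cons andb_addr signr_addb -scalerA.
rewrite (IH _ (supersymmetric_cons Qy Ssym)) /= ?Qx //.
rewrite (Ssym [::] x y (a ++ b)) /= ?Qx ?Qy // scalerA -signr_addb addbb scale1r.
by [].
Qed.

(** Supersymmetry cancels the Koszul signs, so each splitting contributes [S L]; the recursion of
    [unsh] counts the splittings by Pascal's rule. *)
Lemma unsh_supersymmetric S p L : supersymmetric S -> all Q L ->
  unsh (fun a b => if size a == p then S (a ++ b) else 0) L
  = 'C(size L, p)%:R *: S L.
Proof.
elim: L S p => [|x L IH] S p Ssym /=.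
  by case: p => [|p]; rewrite ?bin0 ?scale1r ?bin0n ?scale0r.
move=> /andP[Qx QL].
have Sx := supersymmetric_cons Qx Ssym.
rewrite [X in _ + X](eq_unsh (h' := fun a b =>
  if size a == p then S (x :: a ++ b) else 0)); last first.
  move=> a b pab; case: eqP => _; last by rewrite scaler0.
  by apply: supersymmetric_move; rewrite //= Qx (perm_all _ pab).
rewrite (IH _ p Sx QL); case: p => [|p].
  by rewrite unsh0 // add0r !bin0.
by rewrite (IH _ p Sx QL) -scalerDl -natrD addnC binS.
Qed.

Lemma unsh_supersymmetric_r S k L : supersymmetric S -> all Q L ->
  unsh (fun a b => if size b == k then S (a ++ b) else 0) L
  = 'C(size L, k)%:R *: S L.
Proof.
move=> Ssym QL; have [kL|Lk] := leqP k (size L).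
  rewrite -bin_sub // -(unsh_supersymmetric _ Ssym QL); apply: eq_unsh => a b /perm_size.
  rewrite size_cat => sab; congr (if _ then _ else _).
  by rewrite -(eqn_add2l (size a)) sab -[RHS](eqn_add2r k) subnK // eq_sym.
rewrite bin_small // scale0r; apply: unsh0 => a b /perm_size sab.
by rewrite ifN // neq_ltn (leq_ltn_trans _ Lk) // -sab size_cat leq_addl.
Qed.

End Symmetric.
End Unshuffle.

(** * Homogeneous components and iterated products *)

Section LinearProp.
Variables (K : fieldType) (U V : lmodType K) (g : U -> V).
Hypothesis g_lin : linear g.

Lemma linear_propD x y : g (x + y) = g x + g y.
Proof. by have := g_lin 1 x y; rewrite !scale1r. Qed.

Lemma linear_prop0 : g 0 = 0.
Proof. by apply: (addrI (g 0)); rewrite -linear_propD !addr0. Qed.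

Lemma linear_propZ k x : g (k *: x) = k *: g x.
Proof. by have := g_lin k x 0; rewrite linear_prop0 !addr0. Qed.

Lemma unsh_linear (X : eqType) (h : seq (bool * X) -> seq (bool * X) -> U) L :
  g (unsh h L) = unsh (fun a b => g (h a b)) L.
Proof.
elim: L h => [|x L IH] h //=; rewrite linear_propD !IH; congr (_ + _).
by apply: eq_unsh => a b _; rewrite linear_propZ.
Qed.

End LinearProp.

Section FfunCons.
Variables (T : finType) (n : nat).

Definition fcons (x : T) (g : {ffun 'I_n -> T}) : {ffun 'I_n.+1 -> T} :=
  [ffun i => oapp g x (unlift ord0 i)].

Lemma fcons0 x g : fcons x g ord0 = x.
Proof. by rewrite ffunE unlift_none. Qed.

Lemma fcons_lift x g i : fcons x g (lift ord0 i) = g i.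
Proof. by rewrite ffunE liftK. Qed.

Lemma sum_ffun_recl (V : nmodType) (F : {ffun 'I_n.+1 -> T} -> V) :
  \sum_g F g = \sum_x \sum_g F (fcons x g).
Proof.
rewrite pair_big /= (reindex (fun xg => fcons xg.1 xg.2)) //=.
exists (fun g => (g ord0, [ffun i => g (lift ord0 i)])) => [[x g] _|g _] /=.
  by rewrite fcons0; congr (_, _); apply/ffunP => i; rewrite ffunE fcons_lift.
apply/ffunP => i; case: (unliftP ord0 i) => [j|] ->.
  by rewrite fcons_lift ffunE.
by rewrite fcons0.
Qed.

End FfunCons.

Section SuperLmod.
Variables (K : fieldType) (A : superLmodType K).

Lemma hcomp0 i : hcomp i (0 : A) = 0.
Proof. exact: linear_prop0 (hcomp_is_linear i). Qed.

End SuperLmod.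

(** * Homogeneous components of lists of arguments *)

Section Labels.
Variables (K : fieldType) (A : superalgType K).

Definition homog (x : bool * A) := hcomp x.1 x.2 == x.2.

(** The parities are kept beside the components because a zero component does not determine its
    parity, while [unsh] reads its signs from the labels. *)
Definition labels (n : nat) (par : 'I_n -> bool) (v : seq A) :=
  [seq (par i, hcomp (par i) v`_i) | i <- enum 'I_n].

Lemma labels_hargs n (par : 'I_n -> bool) v :
  [seq x.2 | x <- labels par v] = hargs par v.
Proof. by rewrite -map_comp. Qed.

Lemma labels_homog n (par : 'I_n -> bool) v : all homog (labels par v).
Proof.
by apply/allP => _ /mapP[i _ ->]; rewrite /homog /= hcomp_hcomp eqxx.
Qed.

Lemma size_labels n (par : 'I_n -> bool) v : size (labels par v) = n.
Proof. by rewrite size_map size_enum_ord. Qed.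

Lemma size_hargs n (par : 'I_n -> bool) (v : seq A) : size (hargs par v) = n.
Proof. by rewrite size_map size_enum_ord. Qed.

Lemma hargs_cons n (par : 'I_n.+1 -> bool) (x : A) v :
  hargs par (x :: v) =
  hcomp (par ord0) x :: hargs (fun i => par (lift ord0 i)) v.
Proof. by rewrite /hargs enum_ordSl /= -map_comp. Qed.

Definition multiadditive (V : zmodType) (H : seq A -> V) :=
  forall l x y r, H (l ++ (x + y) :: r) = H (l ++ x :: r) + H (l ++ y :: r).

Lemma sum_hargs (V : zmodType) (H : seq A -> V) v : multiadditive H ->
  \sum_(par : {ffun 'I_(size v) -> bool}) H (hargs par v) = H v.
Proof.
elim: v H => [|x v IH] H Hadd /=.
  rewrite (eq_bigr (fun _ => H [::])) => [|par _].
    by rewrite sumr_const card_ffun card_bool card_ord.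
  by congr H; apply: size0nil; rewrite size_hargs.
rewrite sum_ffun_recl big_bool /= -[in RHS](hcomp_sum x) (Hadd [::]) addrC.
have Hx y : multiadditive (fun l => H (y :: l)).
  by move=> l z t r; apply: (Hadd (y :: l)).
rewrite -2!(IH _ (Hx _)); congr (_ + _); apply: eq_bigr => par _.
  rewrite hargs_cons fcons0; congr (H (_ :: _)).
  by apply: eq_map => i; rewrite fcons_lift.
rewrite hargs_cons fcons0; congr (H (_ :: _)).
by apply: eq_map => i; rewrite fcons_lift.
Qed.

(* Only the parities of the labels themselves contribute to the sum. *)
Lemma sum_labels (V : zmodType) (H : seq (bool * A) -> V) L :
  (forall M, has (fun x => x.2 == 0) M -> H M = 0) -> all homog L ->
  let v := [seq x.2 | x <- L] in
  \sum_(par : {ffun 'I_(size v) -> bool}) H (labels par v) = H L.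
Proof.
move=> H0 Lhom v.
have sv : size v = size L by rewrite size_map.
have vE i : v`_i = (nth (false, 0) L i).2.
  have [iL|Li] := ltnP i (size L); first by rewrite (nth_map (false, 0)).
  by rewrite !nth_default ?sv.
have Lh (i : 'I_(size v)) : hcomp (nth (false, 0) L i).1 v`_i = v`_i.
  by rewrite vE; apply/eqP/(allP Lhom)/mem_nth; rewrite -sv.
rewrite (bigD1 [ffun i : 'I_(size v) => (nth (false, 0) L i).1]) //= big1 ?addr0.
  congr H; apply: (@eq_from_nth _ (false, 0)) => [|i].
    by rewrite size_labels.
  rewrite size_labels => iv; pose j := Ordinal iv.
  rewrite (nth_map j) ?size_enum_ord // -[i]/(nat_of_ord j) nth_ord_enum ffunE Lh vE.
  by case: (nth _ _ _).
move=> par parN; have [i iN] : exists i, par i != (nth (false, 0) L i).1.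
  apply/existsP; apply: contraNT parN => /existsPn parE.
  by apply/eqP/ffunP => i; rewrite ffunE; apply/eqP; rewrite -[_ == _]negbK.
apply: H0; apply/hasP; exists (par i, hcomp (par i) v`_i).
  by apply: map_f; rewrite mem_enum.
by rewrite /= -(Lh i) hcomp_hcomp (negPf iN).
Qed.

End Labels.

(** * Linearity and parity of iterated products *)

Section Smul.
Variables (K : fieldType) (A : superalgType K).
Implicit Types (x y z : A) (l r : seq A).

Notation vals := (map (@snd bool A)).

Lemma foldl_smul_linear l : linear (fun z : A => foldl smul z l).
Proof.
elim: l => [|x l IH] k y z //=.
by rewrite smul_linearl IH.
Qed.

Lemma smul_foldl x y l : smul x (foldl smul y l) = foldl smul (smul x y) l.
Proof. by elim: l y => [|z l IH] y //=; rewrite IH smulA. Qed.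

Lemma foldl_sprod x a l : a != [::] ->
  foldl smul x (sprod a :: l) = foldl smul x (a ++ l).
Proof. by case: a => // y a _; rewrite /= smul_foldl foldl_cat. Qed.

Lemma sprod_cons_sprod a l : a != [::] -> sprod (sprod a :: l) = sprod (a ++ l).
Proof. by case: a => // y a _; rewrite /sprod /= foldl_cat. Qed.

Lemma foldl_smul_homog i x L : hcomp i x = x -> all (@homog K A) L ->
  hcomp (i (+) lpar L) (foldl smul x (vals L)) = foldl smul x (vals L).
Proof.
elim: L i x => [|[j y] L IH] i x xi /=; first by rewrite lpar_nil addbF.
move=> /andP[/eqP yj Lhom]; rewrite lpar_cons addbA; apply: IH => //.
exact: smul_homogeneous.
Qed.

Lemma sprod_homog L : all (@homog K A) L ->
  hcomp (lpar L) (sprod (vals L)) = sprod (vals L).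
Proof.
case: L => [|[i x] L] /=; first by rewrite hcomp0.
by move=> /andP[/eqP xi Lhom]; rewrite lpar_cons; apply: foldl_smul_homog.
Qed.

Lemma foldl_smul_has0 x l : (x == 0) || has (pred1 0) l -> foldl smul x l = 0.
Proof.
elim: l x => [|y l IH] x /=; first by rewrite orbF => /eqP.
move=> H; apply: IH; case/or3P: H => [/eqP->|/eqP->|->]; last by rewrite orbT.
  by rewrite (linear_prop0 (smul_linearl y)) eqxx.
by rewrite (linear_prop0 (smul_linearr x)) eqxx.
Qed.

Lemma sprod_has0 l : has (pred1 0) l -> sprod l = 0.
Proof. by case: l => //= x l; apply: foldl_smul_has0. Qed.

Lemma foldl_smul_multiadditive x : multiadditive (foldl (@smul K A) x).
Proof.
move=> l y z r; rewrite !foldl_cat /= (linear_propD (smul_linearr _)).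
exact: (linear_propD (foldl_smul_linear r)).
Qed.

Lemma sprod_multiadditive : multiadditive (@sprod K A).
Proof.
case=> [|w l] x y r; last exact: foldl_smul_multiadditive.
exact: (linear_propD (foldl_smul_linear r)).
Qed.

Lemma in_degree_multiadditive n (F : cochain A) :
  multiadditive F -> multiadditive (in_degree n F).
Proof.
move=> Fadd l x y r; rewrite /in_degree !size_cat /= Fadd.
by case: ifP; rewrite ?addr0.
Qed.

Lemma mu_multiadditive k : multiadditive (mu k : cochain A).
Proof. exact/in_degree_multiadditive/sprod_multiadditive. Qed.

Lemma cochain_of_operator_multiadditive (f : {linear A -> A}) :
  multiadditive (cochain_of_operator f).
Proof.
move=> l x y r; rewrite /cochain_of_operator /in_degree !size_cat /=.
case: ifP => [|_]; last by rewrite addr0.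
by case: l => [|? ?] /=; rewrite ?addSn ?addnS // linearD.
Qed.

End Smul.

Section ComSmul.
Variables (K : fieldType) (A : comSuperalgType K).
Notation vals := (map (@snd bool A)).

Lemma foldl_smul_supersymmetric (x : A) :
  supersymmetric (@homog K A) (fun L => foldl smul x (vals L)).
Proof.
move=> l [i y] [j z] r; rewrite all_cat /= => /and4P[_ /eqP yi /eqP zj _].
rewrite !map_cat !foldl_cat /= -!smulA (smulC _ _ _ _ zj yi) andbC.
rewrite (linear_propZ (smul_linearr _)).
exact: (linear_propZ (foldl_smul_linear _)).
Qed.

Lemma sprod_supersymmetric : supersymmetric (@homog K A) (fun L => sprod (vals L)).
Proof.
case=> [|[i x] l] [j y] [k z] r; rewrite all_cat /=.
  move=> /and3P[/eqP yj /eqP zk _].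
  rewrite /sprod /= (smulC _ _ _ _ zk yj) andbC.
  exact: (linear_propZ (foldl_smul_linear _)).
rewrite /sprod /= => /and4P[/andP[_ ?] ? ? ?].
by apply: (foldl_smul_supersymmetric x (l := l)); rewrite all_cat /=; apply/and4P.
Qed.

End ComSmul.

(** * Shuffles as subsets *)

Section ShuffleSubset.
Variables (n p : nat).
Hypothesis pn : (p <= n)%N.
Implicit Types (I : {set 'I_n}) (s : 'S_n).

Definition word s := [seq s i | i <- enum 'I_n].

Definition head_set s : {set 'I_n} := [set i in take p (word s)].

Definition split_word I := enum I ++ enum (~: I).

Lemma split_word_uniq I : uniq (split_word I).
Proof.
rewrite cat_uniq !enum_uniq andbT /=; apply/hasPn => i.
by rewrite !mem_enum inE.
Qed.

Lemma size_split_word I : size (split_word I) = n.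
Proof. by rewrite size_cat -!cardE cardsC card_ord. Qed.

Lemma split_perm_inj I : injective (fun i : 'I_n => nth i (split_word I) i).
Proof.
move=> i j; rewrite (set_nth_default j) ?size_split_word // => /eqP.
by rewrite nth_uniq ?size_split_word ?split_word_uniq // => /eqP/val_inj.
Qed.

Definition split_perm I : 'S_n := perm (@split_perm_inj I).

Lemma word_split_perm I : word (split_perm I) = split_word I.
Proof.
have sE := size_split_word I; have wE : size (word (split_perm I)) = n.
  by rewrite size_map size_enum_ord.
have [n0|n0] := posnP n.
  by rewrite (size0nil (etrans wE n0)) (size0nil (etrans sE n0)).
pose d := Ordinal n0; apply: (@eq_from_nth _ d) => [|i]; rewrite wE ?sE // => im.
rewrite (nth_map d) ?size_enum_ord // permE.
rewrite -[i]/(nat_of_ord (Ordinal im)) nth_ord_enum.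
by rewrite (set_nth_default d) // sE.
Qed.

Lemma size_word s : size (word s) = n.
Proof. by rewrite size_map size_enum_ord. Qed.

Lemma nth_word s (i d : 'I_n) : nth d (word s) i = s i.
Proof. by rewrite (nth_map d) ?size_enum_ord // nth_ord_enum. Qed.

Lemma word_uniq s : uniq (word s).
Proof. by rewrite map_inj_uniq ?enum_uniq //; apply: perm_inj. Qed.

Lemma word_inj : injective word.
Proof. by move=> s t st; apply/permP => i; rewrite -!(nth_word _ i i) st. Qed.

Lemma mem_head_set s i : (s i \in head_set s) = (i < p)%N.
Proof.
rewrite inE -(nth_word s i i).
have [ip|pi] := ltnP i p.
  by rewrite -(nth_take i ip) mem_nth // size_take_min leq_min size_word ltn_ord ip.
apply/negP => /(nthP i)[k]; rewrite size_take_min size_word leq_min => /andP[kp kn].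
rewrite nth_take // => /eqP; rewrite nth_uniq ?size_word ?word_uniq // => /eqP ki.
by move: kp; rewrite ki ltnNge pi.
Qed.

Lemma sorted_enum (I : {pred 'I_n}) : sorted (relpre val ltn) (enum I).
Proof.
rewrite -sorted_map; apply: (subseq_sorted ltn_trans _ (iota_ltn_sorted 0 n)).
by rewrite -val_enum_ord {1}/enum_mem -enumT map_subseq // filter_subseq.
Qed.

Lemma sorted_eq_enum (I : {pred 'I_n}) r :
  sorted (relpre val ltn) r -> r =i I -> r = enum I.
Proof.
move=> rs rI; apply: irr_sorted_eq rs (sorted_enum I) _.
- by move=> x y z; apply: ltn_trans.
- by move=> x; apply: ltnn.
- by move=> i; rewrite mem_enum rI.
Qed.

Lemma shuffleP s : reflect
  (forall i j : 'I_n, (i < j)%N -> ((j < p) || (p <= i))%N -> (s i < s j)%N)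
  (s \in shuffle p n).
Proof.
rewrite inE; apply: (iffP forallP) => [H i j ij jp|H i].
  by have /forallP/(_ j) := H i; rewrite ij jp.
by apply/forallP => j; apply/implyP => /andP[ij jp]; apply: H.
Qed.

(** Each block of a shuffle is increasing, and an increasing list is determined by its set of
    entries. Hence the first block determines the shuffle. *)
Lemma word_shuffle s : s \in shuffle p n -> word s = split_word (head_set s).
Proof.
move=> /shuffleP sP; rewrite -[word s](cat_take_drop p); congr (_ ++ _).
  apply: sorted_eq_enum => [|i]; last by rewrite inE.
  case E: (take p (word s)) => [|d t] //; rewrite -E.
    apply/(sortedP d) => i; rewrite size_take_min size_word leq_min.
    move=> /andP[ip im]; rewrite !nth_take ?(ltnW ip) //=.
    rewrite (nth_word s (Ordinal im)) (nth_word s (Ordinal (ltnW im))).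
    by apply: sP; rewrite //= ip.
apply: sorted_eq_enum => [|i].
  case E: (drop p (word s)) => [|d t] //; rewrite -E.
    apply/(sortedP d) => i; rewrite size_drop size_word ltn_subRL addnS.
    move=> im; rewrite !nth_drop addnS /=.
    rewrite (nth_word s (Ordinal im)) (nth_word s (Ordinal (ltnW im))).
    by apply: sP; rewrite //= leq_addr orbT.
have : uniq (take p (word s) ++ drop p (word s)) by rewrite cat_take_drop word_uniq.
rewrite cat_uniq => /and3P[_ /hasPn dis _]; rewrite !inE.
have : i \in take p (word s) ++ drop p (word s).
  by rewrite cat_take_drop -[i](permKV s) map_f // mem_enum.
rewrite mem_cat.
by case: (boolP (i \in drop _ _)) => [/dis /= -> //|_]; rewrite orbF => ->.
Qed.

Lemma split_perm_shuffle I : #|I| = p ->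
  split_perm I \in shuffle p n /\ head_set (split_perm I) = I.
Proof.
move=> Ip; set s := split_perm I.
have tE : take p (word s) = enum I by rewrite word_split_perm -Ip cardE take_size_cat.
have dE : drop p (word s) = enum (~: I) by rewrite word_split_perm -Ip cardE drop_size_cat.
split; last by apply/setP => i; rewrite inE tE mem_enum.
apply/shuffleP => i j ij jp; rewrite -(nth_word s i i) -(nth_word s j i).
case/orP: jp => [jp|pi].
  rewrite -(nth_take i jp) -(nth_take i (ltn_trans ij jp)).
  have st : size (take p (word s)) = p.
    by rewrite size_takel ?size_word // (leq_trans (ltnW jp)) // ltnW.
  apply: (@sorted_ltn_nth _ (relpre val ltn)) => //=; rewrite ?inE ?st //.
  - by move=> x y z; apply: ltn_trans.
  - by rewrite tE; apply: sorted_enum.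
  - exact: ltn_trans jp.
have pj := leq_trans pi (ltnW ij).
rewrite -(subnKC pi) -(subnKC pj) -!nth_drop.
apply: (@sorted_ltn_nth _ (relpre val ltn)) => //=.
- by move=> x y z; apply: ltn_trans.
- by rewrite dE; apply: sorted_enum.
- by rewrite inE size_drop size_word ltn_sub2r // (leq_ltn_trans pi).
- by rewrite inE size_drop size_word ltn_sub2r // (leq_ltn_trans pj).
- by rewrite ltn_sub2r // (leq_ltn_trans pi).
Qed.

Lemma card_head_set s : #|head_set s| = p.
Proof.
rewrite cardsE (card_uniqP _) ?size_takel ?size_word //.
by rewrite take_uniq ?word_uniq.
Qed.

(** Shuffles correspond to [p]-element subsets through [head_set], with inverse [split_perm]. *)
Lemma sum_shuffle (V : nmodType) (F : seq 'I_n -> {set 'I_n} -> V) :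
  \sum_(s in shuffle p n) F (word s) (head_set s) =
  \sum_(I : {set 'I_n} | #|I| == p) F (enum I ++ enum (~: I)) I.
Proof.
rewrite (reindex_onto split_perm head_set) => [|s /word_shuffle ws]; last first.
  by apply: word_inj; rewrite word_split_perm.
apply: eq_big => [I|I /andP[_ /eqP ->]]; last by rewrite word_split_perm.
apply/andP/eqP => [[_ /eqP <-]|/split_perm_shuffle[-> ->]] //.
exact: card_head_set.
Qed.

(** * Koszul signs of shuffles *)

Section Sign.
Variables (K : fieldType) (par : 'I_n -> bool).

(** The inversions of the shuffle of [I] pair an index outside [I] with a larger index of [I]. The
    list [l] is a parameter to allow induction on it. *)
Definition split_sign (I : {set 'I_n}) (l : seq 'I_n) : K :=
  \prod_(b <- l | b \notin I) \prod_(a <- l | (a \in I) && (b < a)%N)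
     (-1) ^+ (par a && par b).

(** A shuffle has no inversion inside a block, so inverted positions satisfy [i < p <= j]; they are
    reindexed by the pair of values [(s j, s i)]. *)
Lemma koszul_shuffle s : s \in shuffle p n ->
  koszul K par s = split_sign (head_set s) (enum 'I_n).
Proof.
move=> /shuffleP sP; rewrite /koszul -prodr_const /split_sign big_enum_cond /=.
under [RHS]eq_bigr do rewrite big_enum_cond /=.
rewrite pair_big_dep /= [RHS](reindex (fun ij : 'I_n * 'I_n => (s ij.2, s ij.1))) /=.
  rewrite big_mkcond [RHS]big_mkcond /=; apply: eq_bigr => -[i j] _ /=.
  rewrite inE /= !mem_head_set.
  have [ji|ij] := ltnP (s j) (s i); last by rewrite !andbF.
  case: (par (s i)) (par (s j)) => [] []; rewrite ?andbF ?expr1 ?expr0 ?if_same //=.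
  rewrite !andbT; congr (if _ then _ else _).
  apply/idP/andP => [ij|[jp ip]]; last by rewrite (leq_trans ip) // leqNgt.
  have : ~~ ((j < p) || (p <= i))%N.
    by apply/negP => /(sP _ _ ij); rewrite ltnNge (ltnW ji).
  by rewrite negb_or -(ltnNge i) => /andP[].
exists (fun ab => ((s^-1)%g ab.2, (s^-1)%g ab.1)) => -[i j] _ /=.
  by rewrite !permK.
by rewrite !permKV.
Qed.

End Sign.
End ShuffleSubset.

Section ShuffleSum.
Variables (n : nat) (K : fieldType) (V : lmodType K) (par : 'I_n -> bool).
Let lab (i : 'I_n) := (par i, i).

(** The new index [x] is the smallest. It is inverted with nothing if it lies in [I], and otherwise
    with every member of [I] in [l]. *)
Lemma split_sign_cons (x : 'I_n) l (I : {set 'I_n}) :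
  all (fun b : 'I_n => x < b)%N l ->
  split_sign K par I (x :: l) =
  (if x \in I then 1
   else (-1) ^+ (par x && lpar [seq lab i | i <- l & i \in I]))
  * split_sign K par I l.
Proof.
move=> /allP xl; rewrite /split_sign big_cons.
have -> : \prod_(b <- l | b \notin I) \prod_(a <- x :: l | (a \in I) && (b < a)%N)
     ((-1) ^+ (par a && par b) : K) =
   \prod_(b <- l | b \notin I) \prod_(a <- l | (a \in I) && (b < a)%N)
     (-1) ^+ (par a && par b).
  rewrite [LHS]big_seq_cond [RHS]big_seq_cond; apply: eq_bigr => b /andP[/xl xb _].
  by rewrite big_cons [(b < x)%N]ltnNge (ltnW xb) andbF.
case xI: (x \in I) => /=; first by rewrite mul1r.
congr (_ * _); rewrite big_cons xI /= -big_filter.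
have -> : [seq a <- l | (a \in I) && (x < a)%N] = [seq a <- l | a \in I].
  by apply: eq_in_filter => a /xl ->; rewrite andbT.
elim: (filter _ _) => [|a r IH]; first by rewrite big_nil lpar_nil andbF.
by rewrite big_cons IH /= lpar_cons andb_addr signr_addb andbC.
Qed.

(** The subsets that contain the first index and those that avoid it give the two branches of
    [unsh]. *)
Lemma sum_subsets_unsh (h : seq (bool * 'I_n) -> seq (bool * 'I_n) -> V) l :
  sorted (relpre val ltn) l ->
  \sum_(I : {set 'I_n} | I \subset [set x in l]) split_sign K par I l *:
    h [seq lab i | i <- l & i \in I] [seq lab i | i <- l & i \notin I]
  = unsh h [seq lab i | i <- l].
Proof.
elim: l h => [|x l IH] h /=.
  move=> _; rewrite (big_pred1 set0) => [|I]; last first.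
    have -> : [set x in [::]] = set0 :> {set 'I_n} by apply/setP => i; rewrite !inE.
    by rewrite subset0.
  by rewrite /split_sign big_nil scale1r.
move=> xl; have {}IH := fun h => IH h (path_sorted xl).
have xl_lt : all (fun b : 'I_n => x < b)%N l.
  by move: xl; rewrite path_sortedE => [/andP[]//|a b c]; apply: ltn_trans.
have lN i : i \in l -> (i == x) = false.
  by move=> /(allP xl_lt) xi; apply/negP => /eqP ix; rewrite ix ltnn in xi.
have xNl : x \notin l by apply/negP => /lN; rewrite eqxx.
rewrite (bigID (fun I : {set 'I_n} => x \in I)) /=; congr (_ + _).
  rewrite -IH (reindex_onto (fun J => x |: J) (fun I => I :\ x)) /=; last first.
    by move=> I /andP[_ xI]; rewrite setD1K.
  apply: eq_big => [J|J].
    rewrite setU11 andbT; apply/andP/subsetP => [[/subsetP Jl /eqP JE] i|Jl].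
      rewrite -JE in_setD1 in_setU1 => /andP[ix]; rewrite (negPf ix) /= => iJ.
      by have := Jl i; rewrite !inE iJ (negPf ix) orbT /=; apply.
    have xNJ : x \notin J by apply: contra xNl => /Jl; rewrite inE.
    split; last by rewrite setU1K.
    by apply/subsetP => i; rewrite !inE => /orP[->//|/Jl]; rewrite inE orbC => ->.
  move=> _; rewrite (split_sign_cons _ xl_lt) setU11 mul1r /=.
  have fE : {in l, forall i, (i \in x |: J) = (i \in J)}.
    by move=> i /lN ix; rewrite !inE ix.
  rewrite (eq_in_filter fE).
  rewrite (@eq_in_filter _ (fun i => i \notin x |: J) (fun i => i \notin J)); last first.
    by move=> i /fE ->.
  congr (_ *: _); rewrite /split_sign; rewrite [LHS]big_seq_cond [RHS]big_seq_cond.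
  apply: eq_big => [i|i _]; first by case il: (i \in l) => //=; rewrite fE.
  rewrite [LHS]big_seq_cond [RHS]big_seq_cond; apply: eq_bigl => j.
  by case jl: (j \in l) => //=; rewrite fE.
rewrite -IH; apply: eq_big => [I|I /andP[_ /negPf xI]].
  apply/andP/subsetP => [[/subsetP Il xI] i iI|Il].
    have := Il i iI; rewrite !inE; case: eqP => // ix.
    by rewrite -ix iI in xI.
  split; last by apply: contra xNl => /Il; rewrite inE.
  by apply/subsetP => i /Il; rewrite !inE orbC => ->.
by rewrite (split_sign_cons _ xl_lt) xI mulrC scalerA.
Qed.

Lemma sum_shuffle_unsh p (h : seq 'I_n -> seq 'I_n -> V) : (p <= n)%N ->
  \sum_(s in shuffle p n) koszul K par s *: h (take p (word s)) (drop p (word s))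
  = unsh (fun a b => if size a == p then h (map snd a) (map snd b) else 0)
      [seq lab i | i <- enum 'I_n].
Proof.
move=> pn; pose F w I := split_sign K par I (enum 'I_n) *: h (take p w) (drop p w).
transitivity (\sum_(s in shuffle p n) F (word s) (head_set p s)).
  by apply: eq_bigr => s sp; rewrite (koszul_shuffle K par sp).
rewrite (sum_shuffle pn) -sum_subsets_unsh ?sorted_enum // big_mkcond.
have fE (J : {set 'I_n}) : [seq i <- enum 'I_n | i \in J] = enum J.
  by rewrite /enum_mem -filter_predI; apply: eq_filter => i /=; rewrite andbT.
have fNE (J : {set 'I_n}) : [seq i <- enum 'I_n | i \notin J] = enum (~: J).
  by rewrite -fE; apply: eq_filter => i; rewrite inE.
have labK r : map snd (map lab r) = r by rewrite -map_comp map_id.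
rewrite [RHS]big_mkcond; apply: eq_bigr => I _.
have -> : I \subset [set i in enum 'I_n].
  by apply/subsetP => i; rewrite inE mem_enum.
rewrite size_map fE fNE !labK -cardE.
case: eqP => [Ip|_]; last by rewrite scaler0.
by rewrite /F take_size_cat ?drop_size_cat // -cardE.
Qed.

End ShuffleSum.

(** * The Nijenhuis-Richardson product as an unshuffle sum *)

Lemma unsh_sum (K : fieldType) (V : lmodType K) (X : eqType) (I : Type) (r : seq I)
    (h : I -> seq (bool * X) -> seq (bool * X) -> V) L :
  \sum_(i <- r) unsh (h i) L = unsh (fun a b => \sum_(i <- r) h i a b) L.
Proof.
elim: r => [|i r IH].
  by rewrite big_nil unsh0 // => a b _; rewrite big_nil.
rewrite big_cons IH -unshD; apply: eq_unsh => a b _.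
by rewrite big_cons.
Qed.

Section ShuffleLabels.
Variables (K : fieldType) (A : superalgType K) (V : lmodType K).
Notation vals := (map (@snd bool A)).

Lemma permute_hargs n (par : 'I_n -> bool) (v : seq A) s :
  permute s (hargs par v) = [seq hcomp (par i) v`_i | i <- word s].
Proof.
rewrite /permute /word -[RHS]map_comp; apply: eq_map => i /=.
by rewrite (nth_map i) ?size_enum_ord // nth_ord_enum.
Qed.

Lemma sum_shuffle_labels n p (par : 'I_n -> bool) v (h : seq A -> seq A -> V) :
  (p <= n)%N ->
  \sum_(s in shuffle p n)
    (let w := permute s (hargs par v) in koszul K par s *: h (take p w) (drop p w))
  = unsh (fun a b => if size a == p then h (vals a) (vals b) else 0) (labels par v).
Proof.
move=> pn; pose g i := hcomp (par i) v`_i; rewrite /=.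
under eq_bigr do rewrite permute_hargs -map_take -map_drop.
rewrite (sum_shuffle_unsh par (fun a b => h (map g a) (map g b)) pn).
have -> : labels par v = map (fun x => (x.1, g x.2)) [seq (par i, i) | i <- enum 'I_n].
  by rewrite -[RHS]map_comp.
by rewrite unsh_map //; apply: eq_unsh => a b _; rewrite size_map -!map_comp.
Qed.

(** The size of the first block selects the single [k] that contributes. The range starts at 1, so
    an empty first block gives 0. *)
Lemma sum_all_shuffles n (par : 'I_n -> bool) v (h : nat -> seq A -> seq A -> V) :
  \sum_(1 <= k < n.+1) \sum_(s in shuffle k n)
    (let w := permute s (hargs par v) in koszul K par s *: h k (take k w) (drop k w))
  = unsh (fun a b => if a == [::] then 0 else h (size a) (vals a) (vals b))
      (labels par v).
Proof.
rewrite big_nat_cond (eq_bigr (fun k => unsh (fun a b =>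
    if size a == k then h k (vals a) (vals b) else 0) (labels par v))); last first.
  by move=> k /andP[/andP[_ kn] _]; apply: sum_shuffle_labels.
rewrite -big_nat_cond unsh_sum; apply: eq_unsh => a b /perm_size.
rewrite size_cat size_labels => sab.
case: eqP => [->|/eqP a0]; first by rewrite big_nat big1 // => -[].
rewrite (bigD1_seq (size a)) ?iota_uniq //= ?mem_index_iota; last first.
  by rewrite ltnS -sab leq_addr lt0n size_eq0 a0.
rewrite eqxx big1_seq ?addr0 // => k /andP[kN _].
by rewrite eq_sym (negPf kN).
Qed.

End ShuffleLabels.

(** * The bracket with a multiplication operator *)

Section Brackets.
Variables (K : fieldType) (A : superalgType K).
Notation vals := (map (@snd bool A)).
Implicit Types (F G : cochain A).

(** The hypotheses make the splitting with empty first part vanish, so the sum may run over all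
    splittings. *)
Lemma barwedge_unsh F G v : (forall l, F (0 :: l) = 0) -> G [::] = 0 ->
  barwedge F G v = \sum_(par : {ffun 'I_(size v) -> bool})
    unsh (fun a b => F (G (vals a) :: vals b)) (labels par v).
Proof.
move=> F0 G0; apply: eq_bigr => par _.
rewrite -(big_mkord predT (fun m => \sum_(s in shuffle m.+1 (size v))
   (let w := permute s (hargs par v) in
    koszul K par s *: F (G (take m.+1 w) :: drop m.+1 w)))).
rewrite -(big_add1 _ _ 0%N (size v).+1 predT
   (fun m => \sum_(s in shuffle m (size v))
   (let w := permute s (hargs par v) in
    koszul K par s *: F (G (take m w) :: drop m w)))).
rewrite (sum_all_shuffles par v (fun _ a b => F (G a :: b))).
by apply: eq_unsh => a b _; case: eqP => // ->; rewrite G0 F0.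
Qed.

Lemma barwedgeD F F' F'' G G' G'' v :
  (forall a l, F (G a :: l) + F' (G' a :: l) = F'' (G'' a :: l)) ->
  barwedge F G v + barwedge F' G' v = barwedge F'' G'' v.
Proof.
move=> H; rewrite -big_split; apply: eq_bigr => par _.
rewrite -big_split; apply: eq_bigr => m _; rewrite -big_split.
by apply: eq_bigr => s _; rewrite /= -scalerDr H.
Qed.

Lemma barwedge0 F G v : (forall a l, F (G a :: l) = 0) -> barwedge F G v = 0.
Proof.
move=> H; rewrite /barwedge big1 // => par _; rewrite big1 // => m _.
by rewrite big1 // => s _; rewrite H scaler0.
Qed.

Lemma eq_barwedge F F' G G' v : F =1 F' -> G =1 G' ->
  barwedge F G v = barwedge F' G' v.
Proof.
move=> FF GG; rewrite -[LHS]addr0 -(@barwedge0 (fun=> 0) (fun=> 0) v) //.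
by apply: barwedgeD => a l; rewrite addr0 GG.
Qed.

Lemma eq_cpart i F F' : F =1 F' -> cpart i F =1 cpart i F'.
Proof. by move=> FF v; apply: eq_bigr => par _; rewrite FF. Qed.

Lemma eq_rho n F F' : F =1 F' -> rho n F =1 rho n F'.
Proof.
move=> FF v; apply: eq_bigr => i _; apply: eq_bigr => j _.
have EF := eq_cpart j FF; congr (_ - _ *: _); exact: eq_barwedge.
Qed.

(** For each choice of parities of the arguments, the two shifts exhaust the two components of the
    value. *)
Lemma cpart_sum F v :
  (forall v, \sum_(par : {ffun 'I_(size v) -> bool}) F (hargs par v) = F v) ->
  cpart true F v + cpart false F v = F v.
Proof.
move=> F_sum; rewrite -[RHS]F_sum -big_split; apply: eq_bigr => par _ /=.
by case: (\big[_/_]_(_ < _) _); rewrite ?hcomp_sum // addrC hcomp_sum.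
Qed.

Lemma lpar_labels n (par : 'I_n -> bool) (v : seq A) :
  lpar (labels par v) = \big[addb/false]_(j < n) par j.
Proof. by rewrite /lpar big_map big_enum. Qed.

Lemma mu_hargs k n (par : 'I_n -> bool) (v : seq A) :
  hcomp (\big[addb/false]_(j < n) par j) (mu k (hargs par v)) = mu k (hargs par v).
Proof.
rewrite /mu /in_degree; case: ifP => _; last exact: hcomp0.
by rewrite -labels_hargs -(lpar_labels par v) sprod_homog ?labels_homog.
Qed.

Lemma cpart_mu_false k : cpart false (mu k : cochain A) =1 mu k.
Proof.
move=> v; rewrite -[RHS](sum_hargs v (@mu_multiadditive _ A k)).
by apply: eq_bigr => par _; rewrite addFb mu_hargs.
Qed.

Lemma cpart_mu_true k (v : seq A) : cpart true (mu k) v = 0.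
Proof.
apply: big1 => par _; rewrite -mu_hargs hcomp_hcomp.
by rewrite addTb; case: (\big[_/_]_(_ < _) _).
Qed.

Lemma mu_0 k l : mu k (0 :: l : seq A) = 0.
Proof. by rewrite /mu /in_degree sprod_has0 ?if_same //= eqxx. Qed.

Lemma mu_D k x y l : mu k (x :: l) + mu k (y :: l) = mu k (x + y :: l : seq A).
Proof. by rewrite (@mu_multiadditive _ _ k [::]). Qed.

(** Since [mu k] is even, its odd part drops out, the signs of the bracket become trivial, and the
    two parts of [F] recombine. *)
Lemma rhoE k F v : (forall l, F (0 :: l) = 0) ->
  (forall v, \sum_(par : {ffun 'I_(size v) -> bool}) F (hargs par v) = F v) ->
  rho k F v = barwedge (mu k) F v - barwedge F (mu k) v.
Proof.
move=> F0 F_sum; rewrite /rho /bracket !big_bool /=.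
have c0 j l : cpart j F (0 :: l) = 0.
  apply: big1 => par _; rewrite hargs_cons hcomp0 F0 hcomp0 //.
have m0 j w : barwedge (cpart true (mu k)) (cpart j F) w = 0.
  by apply: barwedge0 => a l; rewrite cpart_mu_true.
have m0' j w : barwedge (cpart j F) (cpart true (mu k)) w = 0.
  by apply: barwedge0 => a l; rewrite cpart_mu_true c0.
rewrite !m0 !m0' !scaler0 !subr0 !add0r expr0 !scale1r addrACA -opprD.
congr (_ - _); apply: barwedgeD => a l; rewrite ?cpart_mu_false ?cpart_sum //.
by rewrite mu_D cpart_sum.
Qed.

End Brackets.

(** * Action of rho on weighted sums *)

(* [W p q] is the weight of the shuffles for which f is applied to p arguments and
   multiplied by the q others; [rho_coef k W] are the weights of the image under
   [rho k]. The binomials vanish where the subtractions are truncated. *)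
Definition rho_coef (R : pzRingType) (k : nat) (W : nat -> nat -> R)
    (p q : nat) : R :=
  'C(q, k)%:R * W p (q - k)%N
  - ('C(p, k.+1)%:R * W (p - k)%N q + 'C(q, k.+1)%:R * W p (q - k)%N).

Section WeightedSums.
Variables (K : fieldType) (A : comSuperalgType K) (f : {linear A -> A}).
Notation vals := (map (@snd bool A)).
Implicit Types (W : nat -> nat -> K).

Definition wterm W (a b : seq (bool * A)) : A :=
  W (size a) (size b) *: foldl smul (f (sprod (vals a))) (vals b).

(** Sums of this shape are stable under every [rho k], so the computation can be carried out on the
    weights [W]. *)
Definition wsum W : cochain A := fun v =>
  \sum_(par : {ffun 'I_(size v) -> bool}) unsh (wterm W) (labels par v).

(** The empty product is 0 by the default in [sprod], so weights at [p = 0] do not affect the sum;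
    hence the conditions [0 < p] below. *)
Lemma wterm_nil W b : wterm W [::] b = 0.
Proof. by rewrite /wterm linear0 foldl_smul_has0 ?eqxx ?scaler0. Qed.

Lemma unsh_wterm_has0 W L : has (fun x => x.2 == 0) L -> unsh (wterm W) L = 0.
Proof.
move=> L0; apply: unsh0 => a b pab; rewrite /wterm.
have : has (fun x => x.2 == 0) (a ++ b) by rewrite (perm_has _ pab).
rewrite has_cat => H; rewrite foldl_smul_has0 ?scaler0 //.
case/orP: H => [a0|b0]; last by rewrite has_map b0 orbT.
by rewrite sprod_has0 ?linear0 ?eqxx // has_map.
Qed.

Lemma wsum_vals W L : all (@homog K A) L -> wsum W (vals L) = unsh (wterm W) L.
Proof. exact: (sum_labels (H := unsh (wterm W)) (@unsh_wterm_has0 W)). Qed.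

Lemma wsum_hargs W v :
  \sum_(par : {ffun 'I_(size v) -> bool}) wsum W (hargs par v) = wsum W v.
Proof.
by apply: eq_bigr => par _; rewrite -labels_hargs wsum_vals ?labels_homog.
Qed.

Lemma wsum_0 W l : wsum W (0 :: l) = 0.
Proof.
apply: big1 => par _; apply: unsh_wterm_has0.
by rewrite /labels enum_ordSl /= hcomp0 eqxx.
Qed.

Lemma wsum_nil W : wsum W [::] = 0.
Proof.
apply: big1 => par _.
by rewrite [labels _ _]size0nil ?size_labels //= wterm_nil.
Qed.

Lemma eq_wsum n W W' v : (size v = n) ->
  (forall p q, (0 < p)%N -> (p + q)%N = n -> W p q = W' p q) ->
  wsum W v = wsum W' v.
Proof.
move=> vn WW; apply: eq_bigr => par _; apply: eq_unsh => a b /perm_size.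
rewrite size_cat size_labels vn; case: a => [|x a] sab; first by rewrite !wterm_nil.
by rewrite /wterm WW.
Qed.

Lemma wsum_lin (I : finType) (c : I -> K) (W : I -> nat -> nat -> K) v :
  wsum (fun p q => \sum_i c i * W i p q) v = \sum_i c i *: wsum (W i) v.
Proof.
under [RHS]eq_bigr do rewrite scaler_sumr.
rewrite exchange_big; apply: eq_bigr => par _ /=.
under [RHS]eq_bigr do rewrite -unshZ.
rewrite unsh_sum; apply: eq_unsh => a b _; rewrite /wterm scaler_suml.
by apply: eq_bigr => i _; rewrite scalerA.
Qed.

(** Coassociativity merges the [k] new factors with those already outside [f]. A block of [q] outer
    factors arises in ['C(q, k)] ways, all equal by commutativity. *)
Lemma barwedge_mu_wsum k W v :
  barwedge (mu k) (wsum W) v =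
  wsum (fun p q => 'C(q, k)%:R * W p (q - k)%N) v.
Proof.
rewrite barwedge_unsh; [|exact: mu_0|exact: wsum_nil].
apply: eq_bigr => par _; set L := labels par v.
have Lhom : all (@homog K A) L := labels_homog par v.
transitivity (unsh (fun a b => unsh (fun c d => if size b == k then
    W (size c) (size d) *: foldl smul (f (sprod (vals c))) (vals (d ++ b))
    else 0) a) L).
  apply: eq_unsh => a b pab; rewrite wsum_vals; last first.
    by move: Lhom; rewrite -(perm_all _ pab) all_cat => /andP[].
  rewrite /mu /in_degree /= size_map eqSS; case: eqP => bk; last by rewrite unsh0.
  rewrite /sprod /= (unsh_linear (foldl_smul_linear (vals b))).
  apply: eq_unsh => c d _.
  by rewrite /wterm (linear_propZ (foldl_smul_linear _)) map_cat foldl_cat.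
rewrite (unsh_coassoc (fun c d b => if size b == k then
    W (size c) (size d) *: foldl smul (f (sprod (vals c))) (vals (d ++ b)) else 0)).
apply: eq_unsh => c e pce; rewrite /wterm mulrC -scalerA.
have ehom : all (@homog K A) e.
  by move: Lhom; rewrite -(perm_all _ pce) all_cat => /andP[].
rewrite -(unsh_supersymmetric_r k (foldl_smul_supersymmetric _) ehom) -unshZ.
apply: eq_unsh => d b /perm_size; rewrite size_cat => sdb.
by case: eqP => bk; rewrite ?scaler0 // -sdb bk addnK.
Qed.

(** The block of [k.+1] arguments multiplied by [mu k] lands either inside [f] or among the outer
    factors, which gives the two binomials. *)
Lemma barwedge_wsum_mu k W v :
  barwedge (wsum W) (mu k) v =
  wsum (fun p q => 'C(p, k.+1)%:R * W (p - k)%N q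
                   + 'C(q, k.+1)%:R * W p (q - k)%N) v.
Proof.
rewrite barwedge_unsh; [|exact: wsum_0|by []].
apply: eq_bigr => par _; set L := labels par v.
have Lhom : all (@homog K A) L := labels_homog par v.
(* [h1] has the block [a] inside [f], [h2] has it outside. The block counts as one argument, whence
   the successors in the weights. *)
pose h1 (a c d : seq (bool * A)) := if size a == k.+1 then
    W (size c).+1 (size d) *: foldl smul (f (sprod (vals (a ++ c)))) (vals d) else 0.
pose h2 (a c d : seq (bool * A)) := if size a == k.+1 then
    W (size c) (size d).+1 *: foldl smul (f (sprod (vals c))) (vals (a ++ d)) else 0.
transitivity (unsh (fun a b => unsh (h1 a) b
    + unsh (fun c d => (-1) ^+ (lpar a && lpar c) *: h2 a c d) b) L).
  apply: eq_unsh => a b pab.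
  have /andP[ahom bhom] : all (@homog K A) a && all (@homog K A) b.
    by rewrite -all_cat (perm_all _ pab).
  rewrite /mu /in_degree size_map /h1 /h2; case: eqP => ak; last first.
    by rewrite wsum_0 !unsh0 ?addr0 // => *; rewrite ?scaler0.
  have a0 : vals a != [::] by rewrite -size_eq0 size_map ak.
  rewrite (wsum_vals W (L := (lpar a, sprod (vals a)) :: b)) /=; last first.
    by rewrite bhom andbT /homog /= sprod_homog.
  congr (_ + _); apply: eq_unsh => c d _.
    by rewrite /wterm /= sprod_cons_sprod // map_cat.
  by rewrite /wterm map_cat -(foldl_sprod _ _ a0).
(* Coassociativity joins [a] to the arguments [c] of [f]; in the second sum [unsh_swap] groups [a]
   with the outer factors [d]. *)
rewrite unshD -unsh_coassoc unsh_swap -unshD; apply: eq_unsh => p q ppq.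
have /andP[phom qhom] : all (@homog K A) p && all (@homog K A) q.
  by rewrite -all_cat (perm_all _ ppq).
rewrite /wterm scalerDl -!scalerA; congr (_ + _).
  pose g x := foldl smul (f x) (vals q).
  have g_lin : linear g.
    by move=> t x y; rewrite /g linearP foldl_smul_linear.
  have gsym : supersymmetric (@homog K A) (fun L => g (sprod (vals L))).
    by move=> *; rewrite sprod_supersymmetric // (linear_propZ g_lin).
  rewrite [RHS]scalerA mulrC -scalerA -(unsh_supersymmetric k.+1 gsym phom) -unshZ.
  apply: eq_unsh => a c /perm_size; rewrite size_cat /h1 => sac.
  by case: eqP => ak; rewrite ?scaler0 // -sac ak addSnnS addKn.
rewrite [RHS]scalerA mulrC -scalerA.
rewrite -(unsh_supersymmetric k.+1 (foldl_smul_supersymmetric _) qhom) -unshZ.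
apply: eq_unsh => a d /perm_size; rewrite size_cat /h2 => sad.
by case: eqP => ak; rewrite ?scaler0 // -sad ak addSnnS addKn.
Qed.

Lemma rho_wsum k W : rho k (wsum W) =1 wsum (rho_coef k W).
Proof.
move=> v; rewrite rhoE; [|exact: wsum_0|exact: wsum_hargs].
rewrite barwedge_mu_wsum barwedge_wsum_mu -sumrB; apply: eq_bigr => par _.
rewrite -[X in _ - X]scale1r -scaleNr -unshZ -unshD; apply: eq_unsh => a b _.
by rewrite /wterm scaleN1r -scalerBl.
Qed.

Lemma iter_rho_wsum m k W :
  iter m (rho k) (wsum W) =1 wsum (iter m (rho_coef k) W).
Proof.
elim: m => [|m IH] v //=.
by rewrite -rho_wsum; apply: eq_rho.
Qed.

Definition wunit {R : pzRingType} (p q : nat) : R := ((p == 1%N) && (q == 0%N))%:R.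

Lemma cochain_of_operator_wsum : cochain_of_operator f =1 wsum wunit.
Proof.
move=> v; rewrite -[LHS](sum_hargs v (cochain_of_operator_multiadditive f)).
apply: eq_bigr => par _; rewrite -labels_hargs; set L := labels par v.
rewrite /cochain_of_operator /in_degree size_map; case: eqP => [|L1].
  case: L => [|x [|y L]] //= _.
  by rewrite wterm_nil /wterm /= scale1r scaler0 addr0.
rewrite unsh0 // => a b /perm_size sab; rewrite /wterm /wunit.
case: eqP => [a1|]; last by rewrite scale0r.
case: eqP => [b0|]; last by rewrite scale0r.
by case: L1; rewrite -sab size_cat a1 b0.
Qed.

Lemma iter_rho_operator m k l : 
  iter m (rho k) (rho l (cochain_of_operator f)) =1
  wsum (iter m (rho_coef k) (rho_coef l wunit)).
Proof.
move=> v; rewrite -iter_rho_wsum; elim: m v => [|m IH] v /=; last exact: eq_rho.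
by rewrite -rho_wsum; apply/eq_rho/cochain_of_operator_wsum.
Qed.

Lemma antibracket_wsum n (v : n.-tuple A) :
  antibracket f v = wsum (fun p q => (-1) ^+ q) v.
Proof.
rewrite /wsum size_tuple; apply: eq_bigr => par _.
transitivity (\sum_(1 <= k < n.+1) \sum_(s in shuffle k n)
    (let w := permute s (hargs par v) in koszul K par s *:
      ((-1) ^+ (n - k) *: foldl smul (f (sprod (take k w))) (drop k w)))).
  apply: eq_bigr => k _; rewrite scaler_sumr; apply: eq_bigr => s _ /=.
  by rewrite !scalerA mulrC.
rewrite (sum_all_shuffles par v
  (fun k a b => (-1) ^+ (n - k) *: foldl smul (f (sprod a)) b)).
apply: eq_unsh => a b /perm_size; rewrite size_cat size_labels => <-.
by case: eqP => [->|_]; rewrite ?wterm_nil // /wterm addKn.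
Qed.

End WeightedSums.

(** * Linear algebra of the coefficients *)

(** The index is shifted: [k] stands for [rho k.+1]. The ring is arbitrary so that the weights over
    any field are images of integers. *)
Definition rho_basis (R : pzRingType) (n k : nat) : nat -> nat -> R :=
  iter (n - k.+1) (rho_coef 1) (rho_coef k.+1 wunit).

Lemma rho_basisS (R : pzRingType) n k : (k < n)%N ->
  rho_basis R n.+1 k = rho_coef 1 (rho_basis R n k).
Proof. by move=> kn; rewrite /rho_basis subSS -(subnSK kn). Qed.

Lemma rho_basisn (R : pzRingType) n : rho_basis R n.+1 n = rho_coef n.+1 wunit.
Proof. by rewrite /rho_basis subnn. Qed.

Section RhoCoef.
Variable R : comPzRingType.

Lemma rho_coef_lin (I : finType) (c : I -> R) (W : I -> nat -> nat -> R) k p q :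
  rho_coef k (fun p q => \sum_i c i * W i p q) p q
  = \sum_i c i * rho_coef k (W i) p q.
Proof.
rewrite /rho_coef !mulr_sumr -big_split -sumrB; apply: eq_bigr => i _ /=.
by ring.
Qed.

(** These are the weights of [T_1 - T_(k+1)]. *)
Lemma rho_coef_wunit k p q : (0 < k)%N -> (p + q)%N = k.+1 ->
  rho_coef k (wunit : nat -> nat -> R) p q = (p == 1%N)%:R - (q == 0%N)%:R.
Proof.
move=> k0 pq; rewrite /rho_coef /wunit.
have [p1|p1] := eqVneq p 1%N.
  have -> : q = k by lia.
  rewrite p1 subnn binn (bin_small (ltnSn k)) bin_small ?ltnS // !eqxx /=.
  by rewrite (gtn_eqF k0) /=; ring.
have [q0|q0] := eqVneq q 0%N.
  have -> : p = k.+1 by lia.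
  by rewrite q0 binn subSnn sub0n !bin0n (gtn_eqF k0) /= ?eqxx; ring.
by rewrite /= ?andbF ?mulr0n ?(mulr0, addr0, subr0).
Qed.

End RhoCoef.

Notation Wrat := (nat -> nat -> rat).

(** In fixed total degree the weights form a sequence [u], subject to a two-term recursion and two
    boundary equations. *)
Lemma rho_step_inj (n : nat) (w : Wrat) (c : rat) : (0 < n)%N ->
  (forall p q, (0 < p)%N -> (p + q)%N = n.+2 ->
     rho_coef 1 w p q + c * rho_coef n.+1 wunit p q = 0) ->
  c = 0 /\ forall p q, (0 < p)%N -> (p + q)%N = n.+1 -> w p q = 0.
Proof.
move=> n0 H; pose u p := w p (n.+1 - p)%N.
(* Only the equations at [p = 1] and at [q = 0] involve [c]. *)
have e1 : (n.+1%:R - 'C(n.+1, 2)%:R) * u 1%N + c = 0.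
  have := H 1%N n.+1 isT erefl; rewrite rho_coef_wunit // /rho_coef /u bin1 /=.
  by rewrite bin_small // => <-; rewrite subr0; ring.
have eN : 'C(n.+2, 2)%:R * u n.+1 + c = 0.
  have := H n.+2 0%N isT (addn0 _); rewrite rho_coef_wunit ?addn0 // /rho_coef /u.
  by rewrite !bin0n subnn subSS subn0 /= => /eqP; rewrite -oppr_eq0 => /eqP <-; ring.
have e p : (0 < p)%N -> (p < n.+1)%N ->
    ((n.+1 - p)%:R - 'C(n.+1 - p, 2)%:R) * u p.+1 = 'C(p.+1, 2)%:R * u p.
  move=> p0 pn; have pq : (p.+1 + (n.+1 - p) = n.+2)%N by lia.
  have := H p.+1 (n.+1 - p)%N isT pq; rewrite rho_coef_wunit // /rho_coef /u.
  have -> : (p.+1 == 1)%N = false by lia.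
  have -> : (n.+1 - p == 0)%N = false by lia.
  rewrite bin1 subr0 mulr0 addr0 !subn1 /= => /eqP.
  have -> : (n.+1 - p).-1 = (n.+1 - p.+1)%N by lia.
  by move=> /eqP E; apply/eqP; rewrite -subr_eq0; apply/eqP; rewrite -E; ring.
(* The coefficient ['C(p.+1, 2)] is nonzero for [0 < p], so a zero of [u] propagates to smaller
   indices. *)
have down P : (P <= n.+1)%N -> u P = 0 -> forall p, (0 < p <= P)%N -> u p = 0.
  elim: P => [|P IH] Pn uP p; first by case: p.
  case/andP => p0; rewrite leq_eqVlt => /predU1P[->//|pP].
  apply: IH; rewrite ?p0 //; first by lia.
  have P0 : (0 < P)%N by lia.
  have := e P P0 Pn; rewrite uP mulr0 => /esym/eqP; rewrite mulf_eq0 => /orP[|/eqP//].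
  by rewrite pnatr_eq0 -leqn0 leqNgt bin_gt0; lia.
have c0 : c = 0.
  (* For [n = 1] the three equations are solved directly; for [n = 2] the factor of [u 1] in [e1] is
     already zero. *)
  have [n2|n3] : n = 1%N \/ (2 <= n)%N by lia.
    move: e1 eN (e 1%N isT); rewrite n2 => + + /(_ isT).
    rewrite (_ : 'C(3, 2) = 3%N) // (_ : 'C(2, 2) = 1%N) // subn1 /=.
    by rewrite (_ : 'C(1, 2) = 0%N) //; lra.
  have [n2|n4] : n = 2%N \/ (3 <= n)%N by lia.
    by move: e1; rewrite n2 (_ : 'C(3, 2) = 3%N) // subrr mul0r add0r.
  (* This is the recursion at [q = 3], where its left side vanishes; [n >= 3] keeps the index
     positive. *)
  have u0 : u (n - 2)%N = 0.
    have := e (n - 2)%N; rewrite (_ : (n.+1 - (n - 2) = 3)%N); last by lia.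
    rewrite (_ : 'C(3, 2) = 3%N) // subrr mul0r => E.
    have /esym/eqP := E ltac:(lia) ltac:(lia).
    rewrite mulf_eq0 => /orP[|/eqP//].
    by rewrite pnatr_eq0 -leqn0 leqNgt bin_gt0; lia.
  have u1 : u 1%N = 0 by apply: (down (n - 2)%N) => //; lia.
  by move: e1; rewrite u1 mulr0 add0r.
split=> // p q p0 pq; have -> : q = (n.+1 - p)%N by lia.
(* With [c = 0] the equation at [q = 0] gives [u n.+1 = 0]. *)
apply: (down n.+1) => //; last by lia.
move: eN; rewrite c0 addr0 => /eqP; rewrite mulf_eq0 => /orP[|/eqP//].
by rewrite pnatr_eq0 -leqn0 leqNgt bin_gt0.
Qed.

(** All vectors but the last are images under [rho_coef 1] of those of the previous degree, so
    [rho_step_inj] removes the last coefficient and lowers the degree. *)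
Lemma rho_basis_free n (c : nat -> rat) :
  (forall p q, (0 < p)%N -> (p + q)%N = n.+1 ->
     \sum_(k < n) c k * rho_basis _ n k p q = 0) ->
  forall k, (k < n)%N -> c k = 0.
Proof.
elim: n => [|n IH] H k //.
pose w p q := \sum_(k < n) c k * rho_basis rat n k p q.
have Hw p q : (0 < p)%N -> (p + q)%N = n.+2 ->
    rho_coef 1 w p q + c n * rho_coef n.+1 wunit p q = 0.
  move=> p0 pq; rewrite -[RHS](H p q p0 pq) big_ord_recr /= rho_basisn.
  rewrite /w rho_coef_lin; congr (_ + _); apply: eq_bigr => i _.
  by rewrite rho_basisS.
have [n0|n0] := posnP n.
  move=> kn; have -> : k = 0%N by lia.
  have := H 1%N n.+1 isT erefl; rewrite n0 big_ord_recl big_ord0 /rho_basis /=.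
  by rewrite rho_coef_wunit //= subr0 mulr1.
have [cn w0] := rho_step_inj n0 Hw.
rewrite ltnS leq_eqVlt => /predU1P[->//|]; exact: IH.
Qed.

(* The value, for f a derivation D, of the cochain of weight W in units of
   D (a_1 ... a_(n+1)): the shuffles that apply D to i + 1 arguments sum to
   'C(n, i) D (a_1 ... a_(n+1)). The form kills [rho_basis] since rho k D = 0. *)
Definition deriv_form (n : nat) (W : Wrat) : rat :=
  \sum_(i < n.+1) 'C(n, i)%:R * W i.+1 (n - i)%N.

Lemma bin2_rat m : 'C(m, 2)%:R = m%:R * (m%:R - 1) / 2 :> rat.
Proof.
case: m => [|m]; first by rewrite bin0n /= !mul0r.
have : (m.+1 * m)%:R = (2 * 'C(m.+1, 2))%:R :> rat.
  by rewrite -[2%N]/(1.+1) -mul_bin_diag bin1.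
by rewrite !natrM -[m.+1%:R]natr1 => E; lra.
Qed.

(** For a derivation [D], [rho 1] sends the cochain [D (a_1 ... a_(n+1))] to [D (a_1 ... a_(n+2))]
    times [(n+1) - 'C(n+2, 2)], which is [- 'C(n+1, 2)]. *)
Lemma deriv_form_rho n W :
  deriv_form n.+1 (rho_coef 1 W) = - 'C(n.+1, 2)%:R * deriv_form n W.
Proof.
rewrite /deriv_form /rho_coef.
under eq_bigr => i _ do rewrite bin1 opprD addrCA addrC -mulrBl mulrDr mulrN.
(* One extreme term of each sum vanishes; after a shift of the second sum both involve the weights
   [W i.+1 (n - i)]. *)
rewrite big_split sumrN /= [X in X - _]big_ord_recr /=.
rewrite subnn bin0n !mul0r mulr0 addr0 [X in _ - X]big_ord_recl /=.
rewrite (_ : 'C(1, 2) = 0%N) // mul0r mulr0 add0r.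
rewrite -sumrB mulr_sumr; apply: eq_bigr => [[i iN]] _ /=.
rewrite /bump /= add1n !subn1 subSS.
have -> : (n.+1 - i).-1 = (n - i)%N by lia.
have E1 : (n.+1%:R * 'C(n, i)%:R = (n.+1 - i)%:R * 'C(n.+1, i)%:R :> rat).
  by rewrite -!natrM -mul_bin_down.
have E2 : (n.+1%:R * 'C(n, i)%:R = i.+1%:R * 'C(n.+1, i.+1)%:R :> rat).
  by rewrite -!natrM -mul_bin_diag.
rewrite !bin2_rat.
have iE : (n.+1 - i)%:R = n%:R + 1 - i%:R :> rat.
  by rewrite natrB ?natr1 //; lia.
rewrite iE in E1 *; rewrite -[i.+2%:R]natr1 -[i.+1%:R]natr1 -[n.+1%:R]natr1 in E1 E2 *.
set a := 'C(n.+1, i)%:R in E1 *; set b := 'C(n.+1, i.+1)%:R in E2 *.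
set t := W _ _; set m := n%:R in E1 E2 *; set j := i%:R in E1 E2 *.
(* The products in [E1] and [E2] are isolated, so that both become [n + 1] times ['C(n, i)]. *)
transitivity (t * ((2 - m + j) / 2 * ((m + 1 - j) * a) - (j + 2) / 2 * ((j + 1) * b))).
  by field.
by rewrite -E1 -E2; field.
Qed.

Lemma deriv_form_basis n k : (k < n)%N -> deriv_form n (rho_basis rat n k) = 0.
Proof.
elim: n => // n IH; rewrite ltnS leq_eqVlt => /predU1P[->|kn]; last first.
  by rewrite rho_basisS // deriv_form_rho IH ?mulr0.
(* Only the two ends have nonzero weight, 1 and -1, and both binomials there are 1. *)
rewrite rho_basisn /deriv_form big_ord_recl big_ord_recr /=.
rewrite big1 ?add0r => [|i _]; last first.
  rewrite rho_coef_wunit //; last by have := ltn_ord i; rewrite /bump /=; lia.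
  by rewrite /bump /= subn_eq0 add1n ltnNge ltn_ord subr0 mulr0.
rewrite !rho_coef_wunit //; try by rewrite /bump /=; lia.
by rewrite bin0 /bump /= add1n binn subnn /= subr0 sub0r mulr1 addrN.
Qed.

(** This is the binomial expansion of [(-1 + 1) ^+ n]. *)
Lemma deriv_form_antibracket n : (0 < n)%N ->
  deriv_form n (fun p q => (-1) ^+ q) = 0.
Proof.
move=> n0; have := exprDn (-1 : rat) 1 n.
rewrite addNr expr0n (gtn_eqF n0) => /esym E; rewrite -[RHS]E.
by apply: eq_bigr => i _; rewrite expr1n mulr1 mulr_natl.
Qed.

Lemma rho_basis_span n : (0 < n)%N -> exists c : nat -> rat, forall p q,
  (0 < p)%N -> (p + q)%N = n.+1 ->
  \sum_(k < n) c k * rho_basis rat n k p q = (-1) ^+ q.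
Proof.
move=> n0; pose M := \matrix_(k < n, i < n.+1) rho_basis rat n k i.+1 (n - i).
pose phi : 'cV[rat]_n.+1 := \col_i 'C(n, i)%:R.
pose t : 'rV[rat]_n.+1 := \row_i (-1) ^+ (n - i).
have Mfree : row_free M.
  apply: inj_row_free => v vM; apply/rowP => k; rewrite [RHS]mxE.
  (* [rho_basis_free] takes coefficients indexed by [nat], so [v] is extended by 0. *)
  pose c k := if insub k is Some j then v 0 j else 0.
  have cE (j : 'I_n) : c j = v 0 j by rewrite /c valK.
  rewrite -cE; apply: (@rho_basis_free n) => // -[//|p] q _ pq.
  have pn : (p < n.+1)%N by lia.
  have /rowP/(_ (Ordinal pn)) := vM; rewrite !mxE => E; rewrite -[RHS]E.
  by apply: eq_bigr => j _; rewrite cE mxE /=; congr (_ * rho_basis _ _ _ _ _); lia.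
have Mphi : M *m phi = 0.
  apply/colP => k; rewrite !mxE -[RHS](deriv_form_basis (ltn_ord k)) /deriv_form.
  by apply: eq_bigr => i _; rewrite !mxE mulrC.
have tphi : t *m phi = 0.
  apply/colP => k; rewrite !mxE -[RHS](deriv_form_antibracket n0) /deriv_form.
  by apply: eq_bigr => i _; rewrite !mxE mulrC.
have phi1 : \rank phi = 1%N.
  apply/eqP; rewrite eqn_leq rank_leq_col lt0n mxrank_eq0.
  by apply/eqP => /colP/(_ ord0)/eqP; rewrite !mxE bin0.
(* The row space of [M] lies in this kernel and both have rank [n]. *)
have kerM : (kermx phi <= M)%MS.
  rewrite -(geq_leqif (mxrank_leqif_sup _)); last exact/sub_kermxP.
  by rewrite mxrank_ker phi1 subn1 /= (eqP Mfree).
have /submxP[c tE] : (t <= M)%MS by apply: submx_trans kerM; apply/sub_kermxP.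
exists (fun k => if insub k is Some j then c 0 j else 0) => -[//|p] q _ pq.
have pn : (p < n.+1)%N by lia.
have := tE => /rowP/(_ (Ordinal pn)); rewrite !mxE /= (_ : (n - p = q)%N); last by lia.
move=> ->; apply: eq_bigr => j _; rewrite valK mxE /=.
by congr (_ * rho_basis _ _ _ _ _); lia.
Qed.

(** * Specialization to fields and to the polynomial algebra *)

Lemma rho_coef_rmorph (R S : pzRingType) (phi : {rmorphism R -> S}) k
    (W : nat -> nat -> R) (W' : nat -> nat -> S) :
  (forall p q, W' p q = phi (W p q)) ->
  forall p q, rho_coef k W' p q = phi (rho_coef k W p q).
Proof.
by move=> WE p q; rewrite /rho_coef !WE rmorphB rmorphD !rmorphM !rmorph_nat.
Qed.

Lemma rho_basis_rmorph (R S : pzRingType) (phi : {rmorphism R -> S}) n k p q :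
  rho_basis S n k p q = phi (rho_basis R n k p q).
Proof.
rewrite /rho_basis; elim: (n - k.+1)%N p q => [|m IH] /=; apply: rho_coef_rmorph => //.
by move=> p q; rewrite /wunit rmorph_nat.
Qed.

(* The library has these only for ordered fields. *)
Section RatrChar0.
Variable K : fieldType.
Hypothesis charK : [pchar K] =i pred0.

Lemma intr_eq0_pchar0 (z : int) : (z%:~R == 0 :> K) = (z == 0).
Proof.
have /pcharf0P nat0 := charK.
by case: z => m; rewrite ?NegzE ?mulrNz ?oppr_eq0 -pmulrn nat0.
Qed.

Lemma ratr_fracq (a b : int) : b != 0 ->
  ratr (a%:~R / b%:~R) = a%:~R / b%:~R :> K.
Proof.
move=> b0; set x : rat := _ / _; rewrite /ratr.
have bQ : b%:~R != 0 :> rat by rewrite intr_eq0.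
have E : numq x * b = a * denq x.
  apply: (@intr_inj rat); rewrite !intrM; apply/eqP.
  by rewrite -eqr_div ?intr_eq0 // divq_num_den.
have bK : b%:~R != 0 :> K by rewrite intr_eq0_pchar0.
have dK : (denq x)%:~R != 0 :> K by rewrite intr_eq0_pchar0.
by apply/eqP; rewrite eqr_div // -!intrM E.
Qed.

(** The weights are integers, so [ratr] need only respect integer combinations. This follows by
    clearing denominators, which stay invertible in [K]. *)
Lemma ratr_lin_intr (I : Type) (r : seq I) (c : I -> rat) (z : I -> int) :
  ratr (\sum_(i <- r) c i * (z i)%:~R) = \sum_(i <- r) ratr (c i) * (z i)%:~R :> K.
Proof.
have dK (x : rat) : (denq x)%:~R != 0 :> K by rewrite intr_eq0_pchar0.
have dQ (x : rat) : (denq x)%:~R != 0 :> rat by rewrite intr_eq0.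
elim: r => [|i r IH].
  by rewrite !big_nil -[0 in LHS](mul0r (1%:~R)^-1) (ratr_fracq 0) // mul0r.
rewrite !big_cons -IH; set y := \sum_(i <- _) _; set x := c i; set t := z i.
have -> : x * t%:~R + y = (numq x * t * denq y + numq y * denq x)%:~R
                          / (denq x * denq y)%:~R.
  rewrite -[x in LHS]divq_num_den -[y in LHS]divq_num_den.
  by rewrite !intrD !intrM; field; rewrite !dQ.
rewrite ratr_fracq ?mulf_neq0 ?denq_neq0 // /ratr !intrD !intrM.
by field; rewrite !dK.
Qed.

End RatrChar0.

(** * The polynomial algebra as a purely even superalgebra *)

Definition evenpoly (F : fieldType) : Type := {poly F}.

Section EvenPoly.
Variable F : fieldType.

HB.instance Definition _ := GRing.Lmodule.copy (evenpoly F) {poly F}.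

Definition evenpoly_hcomp (i : bool) (p : evenpoly F) : evenpoly F :=
  if i then 0 else p.

Lemma evenpoly_hcomp_linear i : linear (evenpoly_hcomp i).
Proof. by case: i => k p q //=; rewrite scaler0 addr0. Qed.

Lemma evenpoly_hcompK i j p : evenpoly_hcomp i (evenpoly_hcomp j p) =
  if i == j then evenpoly_hcomp j p else 0.
Proof. by case: i j => [] []. Qed.

Lemma evenpoly_hcomp_sum p : evenpoly_hcomp false p + evenpoly_hcomp true p = p.
Proof. exact: addr0. Qed.

HB.instance Definition _ := Lmodule_isSuper.Build F (evenpoly F)
  evenpoly_hcomp_linear evenpoly_hcompK evenpoly_hcomp_sum.

Definition evenpoly_mul (p q : evenpoly F) : evenpoly F := (p : {poly F}) * q.

Lemma evenpoly_mulA : associative evenpoly_mul.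
Proof. exact: mulrA. Qed.

Lemma evenpoly_mul_linearl q : linear (evenpoly_mul^~ q).
Proof. by move=> k x y; rewrite /evenpoly_mul mulrDl scalerAl. Qed.

Lemma evenpoly_mul_linearr q : linear (evenpoly_mul q).
Proof. by move=> k x y; rewrite /evenpoly_mul mulrDr scalerAr. Qed.

Lemma evenpoly_homogeneous_true (p : evenpoly F) : homogeneous true p -> p = 0.
Proof. by move=> <-. Qed.

Lemma evenpoly_mul_homogeneous i j p q : homogeneous i p -> homogeneous j q ->
  homogeneous (i (+) j) (evenpoly_mul p q).
Proof.
case: i j => [] [] // ip jq; rewrite /homogeneous /evenpoly_mul.
  by rewrite (evenpoly_homogeneous_true ip) mul0r.
by rewrite (evenpoly_homogeneous_true jq) mulr0.
Qed.

HB.instance Definition _ := SuperLmodule_isSuperalgebra.Build F (evenpoly F)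
  evenpoly_mulA evenpoly_mul_linearl evenpoly_mul_linearr evenpoly_mul_homogeneous.

Lemma evenpoly_mulC i j (p q : evenpoly F) : homogeneous i p -> homogeneous j q ->
  smul p q = (-1) ^+ (i && j) *: smul q p.
Proof.
case: i j => [] [] ip jq /=; rewrite ?expr0 ?scale1r; try exact: mulrC.
by rewrite (evenpoly_homogeneous_true ip) [LHS]mul0r [smul _ _]mulr0 scaler0.
Qed.

HB.instance Definition _ :=
  Superalgebra_isCommutative.Build F (evenpoly F) evenpoly_mulC.

Definition monomial_part (j : nat) (p : evenpoly F) : evenpoly F :=
  (p : {poly F})`_j *: ('X^j : {poly F}).

Lemma monomial_part_linear j : linear (monomial_part j).
Proof. by move=> k p q; rewrite /monomial_part coefD coefZ scalerDl scalerA. Qed.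

HB.instance Definition _ j := GRing.isLinear.Build F (evenpoly F) (evenpoly F) _
  (monomial_part j) (monomial_part_linear j).

Lemma foldl_smul_nseqX (p : evenpoly F) m :
  foldl smul p (nseq m ('X : evenpoly F)) = (p : {poly F}) * 'X^m.
Proof.
elim: m p => [|m IH] p /=; first by rewrite mulr1.
by rewrite IH exprS mulrA.
Qed.

(* Taking all arguments equal to X and f the projection onto the monomial X^j
   isolates the coefficient of the summand in which f is applied to j factors. *)
Lemma wsum_monomial_part (j N : nat) (W : nat -> nat -> F) : (0 < j)%N ->
  wsum (monomial_part j) W (nseq N ('X : evenpoly F)) =
  ('C(N, j)%:R * W j (N - j)%N) *: ('X^N : {poly F}).
Proof.
move=> j0; pose x : bool * evenpoly F := (false, 'X).
have -> : nseq N ('X : evenpoly F) = [seq y.2 | y <- nseq N x] by rewrite map_nseq.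
rewrite wsum_vals; last by rewrite all_nseq [homog _]eqxx orbT.
rewrite -scalerA -{2}(size_nseq N x).
(* The nonzero summands are all equal, so they are counted by [unsh_supersymmetric] for a constant
   function, which is supersymmetric on even labels. *)
pose S (_ : seq (bool * evenpoly F)) : evenpoly F := W j (N - j)%N *: ('X^N : {poly F}).
have Ssym : supersymmetric (fun y => ~~ y.1) S.
  move=> l y z r; rewrite all_cat /= => /and4P[_ /negPf -> _ _].
  by rewrite scale1r.
have Qx : all (fun y : bool * evenpoly F => ~~ y.1) (nseq N x) by rewrite all_nseq orbT.
rewrite -[_ *: _]/(_ *: S (nseq N x)).
have := unsh_supersymmetric j Ssym Qx; rewrite !size_nseq => <-.
apply: eq_unsh => a b pab.
have : all (pred1 x) (a ++ b) by rewrite (perm_all _ pab) all_nseq /= eqxx orbT.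
rewrite all_cat => /andP[/all_pred1P aE /all_pred1P bE].
have sab : (size a + size b = N)%N by rewrite -size_cat (perm_size pab) size_nseq.
rewrite /wterm aE bE !size_nseq !map_nseq /= foldl_smul_nseqX /S.
case: (size a) sab => [|m] sab.
  by rewrite ltn_eqF // linear0 mul0r scaler0.
rewrite /= /sprod /= foldl_smul_nseqX -exprS /monomial_part coefXn.
rewrite [j == _]eq_sym; case: eqP => [mj|_]; last by rewrite scale0r mul0r scaler0.
by rewrite scale1r -exprD mj -sab mj addKn.
Qed.

End EvenPoly.

Theorem theorem2p3 (n : nat) (hn : (0 < n)%N) :
  exists! c : n.-tuple rat,
    forall (K : fieldType) (charK : [pchar K] =i pred0)
           (A : comSuperalgType K) (f : {linear A -> A}) (v : n.+1.-tuple A),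
      antibracket f v =
      \sum_(k < n) ratr (tnth c k) *:
        iter (n - k.+1) (rho 1) (rho k.+1 (cochain_of_operator f)) v.
Proof.
have rhsE (c : n.-tuple rat) (K : fieldType) (A : comSuperalgType K)
    (f : {linear A -> A}) (v : seq A) :
    \sum_(k < n) ratr (tnth c k) *:
      iter (n - k.+1) (rho 1) (rho k.+1 (cochain_of_operator f)) v
    = wsum f (fun p q => \sum_(k < n) ratr (tnth c k) * rho_basis K n k p q) v.
  rewrite wsum_lin; apply: eq_bigr => k _.
  by rewrite iter_rho_operator.
have [c cE] := rho_basis_span hn.
exists [tuple c k | k < n]; split.
  move=> K charK A f v; rewrite rhsE antibracket_wsum.
  apply: (@eq_wsum _ _ f n.+1) => [|p q p0 pq]; first by rewrite size_tuple.
  (* The sign is written as the image of a rational number, which [cE] then expands in the basis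
     before [ratr] is distributed. *)
  transitivity (ratr ((-1) ^+ q)%:~R : K).
    by rewrite ratr_int rmorphXn rmorphN1.
  rewrite rmorphXn rmorphN1 -(cE p q p0 pq).
  under eq_bigr do rewrite (rho_basis_rmorph intr).
  rewrite ratr_lin_intr //; apply: eq_bigr => k _.
  by rewrite tnth_mktuple [in RHS](rho_basis_rmorph intr).
have charQ : [pchar rat] =i pred0 by apply: pchar_num.
move=> c' c'E; apply: eq_from_tnth => i; rewrite tnth_mktuple; apply/eqP.
pose d k := if insub k is Some j then c k - tnth c' j else 0.
have dE (k : 'I_n) : d k = c k - tnth c' k by rewrite /d valK.
rewrite -subr_eq0 -dE; apply/eqP/(@rho_basis_free n) => // p q p0 pq.
under eq_bigr do rewrite dE mulrBl.
rewrite sumrB cE //; apply/eqP; rewrite subr_eq0; apply/eqP.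
(* Testing on [monomial_part p] compares the weights at [p] alone, up to the nonzero factor
   ['C(n.+1, p)]. *)
have := c'E rat charQ (evenpoly rat) (monomial_part p) [tuple of nseq n.+1 'X].
rewrite rhsE antibracket_wsum !wsum_monomial_part //.
move=> /(congr1 (fun r : {poly rat} => r`_n.+1)).
rewrite !coefZ coefXn eqxx !mulr1.
rewrite (_ : (n.+1 - p = q)%N); last by lia.
have Cn0 : 'C(n.+1, p)%:R != 0 :> rat by rewrite pnatr_eq0 -lt0n bin_gt0; lia.
move=> /(mulfI Cn0) ->; apply: eq_bigr => k _; congr (_ * _).
by rewrite /ratr divq_num_den.
Qed.
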